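(* Let $\mathcal{H}$ be a complex Hilbert space and let $f:\mathbb{D}\to\mathcal{B}(\mathcal{H})$ be an operator valued bounded holomorphic function with expansion $f(z)=\sum_{k=0}^{\infty}A_kz^k$ in $\mathbb{D}$, where $A_k\in\mathcal{B}(\mathcal{H})$ for all $k\ge 0$ and $A_0=a_0I$ with $a_0\in\mathbb{C}$, $|a_0|<1$. If $\|f(z)\|\le 1$ in $\mathbb{D}$, then for every $p\in(0,1]$ and every integer $N\ge 1$, $$\|f(z)\|^p+\sum_{k=N}^{\infty}\|A_k\|r^k\le 1\qquad\text{for } |z|=r\le R_{N,p},$$ where $R_{N,p}$ is the unique root in $(0,1)$ of the equation $$2(1+r)r^N-p(1-r)^2=0.$$ The constant $R_{N,p}$ is the best possible, i.e. for every $r\in(R_{N,p},1)$ there are a holomorphic function $f:\mathbb{D}\to\mathcal{B}(\mathcal{H})$, $f(z)=\sum_{k=0}^{\infty}A_kz^k$, with $A_k\in\mathcal{B}(\mathcal{H})$ for all $k\ge 0$, $A_0=a_0I$ for some $a_0\in\mathbb{C}$, $|a_0|<1$, and $\|f(z)\|\le 1$ in $\mathbb{D}$, and a point $z$ with $|z|=r$ for which the inequality fails.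
   Context: $\mathbb{D}=\{z\in\mathbb{C}:|z|<1\}$; $\mathcal{B}(\mathcal{H})$ is the algebra of all bounded linear operators on $\mathcal{H}$ with the operator norm $\|\cdot\|$; $I$ is the identity operator on $\mathcal{H}$. *)

(* Defs.v *)
From HB Require Import structures.
From mathcomp Require Import all_boot all_order all_algebra.
From mathcomp Require Import complex.
From mathcomp Require Import all_classical all_reals all_analysis.

Set Implicit Arguments.
Unset Strict Implicit.
Unset Printing Implicit Defensive.

Import Order.TTheory GRing.Theory Num.Theory.
Import numFieldNormedType.Exports.

Local Open Scope classical_set_scope.
Local Open Scope ring_scope.
Local Open Scope complex_scope.

(* The norm of a normed module over R[i] takes its values in R[i] (as
   nonnegative reals); [inner] is linear in its first argument. *)
HB.mixin Record CompleteNormedModule_isHilbert (R : realType) H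
    & CompleteNormedModule R[i] H := {
  inner : {dot H for @Num.conj R[i]};
  sqr_normE : forall x : H, `|x| ^+ 2 = inner x x
}.

#[short(type="hilbertType")]
HB.structure Definition Hilbert (R : realType) :=
  { H of CompleteNormedModule R[i] H & CompleteNormedModule_isHilbert R H }.

Section BoundedOperators.
Variables (R : realType) (H : hilbertType R).

Let real_complexD (x y : R) : (x + y)%:C = x%:C + y%:C.
Proof. exact: rmorphD. Qed.

Let real_complexM (x y : R) : (x * y)%:C = x%:C * y%:C.
Proof. exact: rmorphM. Qed.

Let normr_Re (V : normedModType R[i]) (x : V) : (complex.Re `|x|)%:C = `|x|.
Proof. by rewrite RRe_real ?normr_real. Qed.

Let normc_Re (x : R[i]) : (complex.Re `|x|)%:C = `|x|.
Proof. by rewrite RRe_real ?normr_real. Qed.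

Definition bounded_linear : {pred H -> H} := fun f =>
  `[< linear f /\ exists M : R, forall x, `|f x| <= M%:C * `|x| >].

Fact bounded_linear_submod_closed : submod_closed bounded_linear.
Proof.
split.
- apply/asboolP; split; first by move=> a x y /=; rewrite scaler0 addr0.
  by exists 0 => x; rewrite normr0 mul0r.
- move=> a f g /asboolP [lf [M fM]] /asboolP [lg [M' gM]]; apply/asboolP.
  split=> [k x y|].
    rewrite -[LHS]/(a *: f _ + g _) -[RHS]/(k *: (a *: f x + g x) + (a *: f y + g y)).
    by rewrite lf lg !scalerDr !scalerA [a * k]mulrC addrACA.
  exists (complex.Re `|a| * M + M') => x.
  rewrite -[leLHS]/(`|a *: f x + g x|) real_complexD real_complexM normc_Re.
  rewrite mulrDl (le_trans (ler_normD _ _))//.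
  by apply: lerD; [rewrite normrZ -mulrA ler_wpM2l// fM|exact: gM].
Qed.

HB.instance Definition _ := GRing.isSubmodClosed.Build R[i] (H -> H)
  bounded_linear bounded_linear_submod_closed.

Record boundedOp := BoundedOp {
  op_fun :> H -> H;
  op_funP : op_fun \in bounded_linear }.

HB.instance Definition _ := [isSub for op_fun].
HB.instance Definition _ := [Choice of boundedOp by <:].
HB.instance Definition _ := [SubChoice_isSubLmodule of boundedOp by <:].

Definition opnorm (A : boundedOp) : R :=
  sup [set complex.Re `|A x| | x in [set x : H | `|x| <= 1]].

Fact id_bounded_linear : (id : H -> H) \in bounded_linear.
Proof. by apply/asboolP; split=> //; exists 1 => x; rewrite mul1r. Qed.

Definition id_op : boundedOp := BoundedOp id_bounded_linear.

Lemma op_linear (A : boundedOp) : linear A.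
Proof. by have /asboolP[] := op_funP A. Qed.

Lemma op_bounded (A : boundedOp) : exists M : R, forall x, `|A x| <= M%:C * `|x|.
Proof. by have /asboolP[] := op_funP A. Qed.

Lemma opnorm_has_sup (A : boundedOp) :
  has_sup [set complex.Re `|A x| | x in [set x : H | `|x| <= 1]].
Proof.
split; first by exists (complex.Re `|A 0|); exists 0 => //=; rewrite normr0.
have [M AM] := op_bounded A; exists `|M|; apply/ubP => _ [x /= x1 <-].
rewrite -lecR normr_Re (le_trans (AM x))//.
rewrite (@le_trans _ _ (`|M|%:C * `|x|))//.
  by rewrite ler_wpM2r// lecR ler_norm.
by rewrite ler_piMr// ler0c.
Qed.

Lemma opnorm_ge0 (A : boundedOp) : 0 <= opnorm A.
Proof.
rewrite (@le_trans _ _ (complex.Re `|A 0|))//.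
  by rewrite -ler0c normr_Re.
apply: ub_le_sup; first by have [] := opnorm_has_sup A.
by exists 0 => //=; rewrite normr0.
Qed.

Lemma le_opnorm (A : boundedOp) x : `|A x| <= (opnorm A)%:C * `|x|.
Proof.
have A0 : A 0 = 0.
  by have := op_linear A (-1) 0 0; rewrite !scaleN1r oppr0 addr0 addNr.
have AZ k y : A (k *: y) = k *: A y.
  by have := op_linear A k y 0; rewrite A0 !addr0.
have [->|x0] := eqVneq x 0; first by rewrite A0 !normr0 mulr0.
have nx : 0 < `|x| by rewrite normr_gt0.
rewrite -ler_pdivrMr// mulrC -[X in X * _]ger0_norm ?invr_ge0//.
rewrite -normrZ -AZ -normr_Re lecR.
apply: ub_le_sup; first by have [] := opnorm_has_sup A.
by exists (`|x|^-1 *: x) => //=; rewrite normrZ ger0_norm ?invr_ge0// mulVf ?gt_eqF.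
Qed.

Lemma opnorm_le (A : boundedOp) (M : R) : 0 <= M ->
  (forall x, `|A x| <= M%:C * `|x|) -> opnorm A <= M.
Proof.
move=> M0 AM; apply: ge_sup; first by have [] := opnorm_has_sup A.
move=> _ [x /= x1 <-]; rewrite -lecR normr_Re (le_trans (AM x))//.
by rewrite ler_piMr// ler0c.
Qed.

Lemma opnormD (A B : boundedOp) :
  (opnorm (A + B))%:C <= (opnorm A)%:C + (opnorm B)%:C.
Proof.
rewrite -real_complexD lecR; apply: opnorm_le; first by rewrite addr_ge0 ?opnorm_ge0.
move=> x; rewrite -[(A + B) x]/(A x + B x) real_complexD mulrDl.
by rewrite (le_trans (ler_normD _ _))// lerD// le_opnorm.
Qed.

Lemma opnormZ (a : R[i]) (A : boundedOp) :
  (opnorm (a *: A))%:C = `|a| * (opnorm A)%:C.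
Proof.
have na : (complex.Re `|a|)%:C = `|a| by exact: normc_Re.
have ra : 0 <= complex.Re `|a| by rewrite -ler0c na.
have le1 b B : (opnorm (b *: B))%:C <= `|b| * (opnorm B)%:C.
  have nb : (complex.Re `|b|)%:C = `|b| by exact: normc_Re.
  rewrite -nb -real_complexM lecR; apply: opnorm_le.
    by rewrite mulr_ge0 ?opnorm_ge0// -ler0c nb.
  move=> x; rewrite -[(b *: B) x]/(b *: B x) normrZ real_complexM nb -mulrA.
  by rewrite ler_wpM2l// le_opnorm.
apply/eqP; rewrite eq_le le1/=.
have [->|a0] := eqVneq a 0; first by rewrite normr0 mul0r ler0c opnorm_ge0.
have := le1 a^-1 (a *: A); rewrite scalerA mulVf// scale1r normfV.
by rewrite ler_pdivlMl ?normr_gt0.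
Qed.

Lemma opnorm0_eq0 (A : boundedOp) : (opnorm A)%:C = 0 -> A = 0.
Proof.
move=> A0; apply/val_inj/funext => x /=.
apply/eqP; rewrite -normr_le0; have := le_opnorm A x.
by rewrite A0 mul0r.
Qed.

HB.instance Definition _ := Lmodule_isNormed.Build R[i] boundedOp
  opnormD opnormZ opnorm0_eq0.

Lemma normopE (A : boundedOp) : `|A| = (opnorm A)%:C.
Proof. by []. Qed.

(* Only the values of [f] on the open unit disk matter. *)
Definition holomorphic_on_disk (f : R[i]^o -> boundedOp) : Prop :=
  forall z : R[i]^o, `|z| < 1 -> derivable f z 1.

Definition power_expansion_on_disk (f : R[i]^o -> boundedOp)
    (A : nat -> boundedOp) : Prop :=
  forall z : R[i]^o, `|z| < 1 -> series (fun k => z ^+ k *: A k) @ \oo --> f z.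

(* Boundedness of [f] on the disk is implied by the last conjunct. *)
Definition contractive_with_scalar_A0 (f : R[i]^o -> boundedOp)
    (A : nat -> boundedOp) : Prop :=
  [/\ holomorphic_on_disk f,
      power_expansion_on_disk f A,
      exists2 a0 : R[i], `|a0| < 1 & A 0%N = a0 *: id_op &
      forall z : R[i]^o, `|z| < 1 -> opnorm (f z) <= 1].

End BoundedOperators.

(* Main.v *)
(* Write a = |a_0| and r = |z|. As |f| <= 1, averaging |f(w) P(w)|^2 over the
   M-th roots of unity scaled by rho < 1 (discrete Parseval), with f replaced by
   a long partial sum of its expansion, and letting rho -> 1, shows that every
   finite lower triangular Toeplitz matrix (A_(n-j)) is a contraction. Since A_0
   is the scalar a_0, testing it on vectors supported at 0 and k gives
   |A_k| <= 1 - a^2, and testing it on the geometric vectors (z^(m-j) y)_j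
   perturbed at j = m gives, as m -> oo, the Schwarz-Pick bound
   |f(z)| <= (a + r) / (1 + a r). With x^p <= 1 - p (1 - x) the inequality
   becomes (1 + a) (1 + a r) r^N <= p (1 - r)^2, whose worst case is a = 1.
   Conversely f(z) = (a - z) / (1 - a z) at z = - r violates the inequality for a
   close to 1 as soon as 2 (1 + r) r^N > p (1 - r)^2. *)

From HB Require Import structures.
Require Import Defs.
From mathcomp Require Import all_boot all_order all_algebra.
From mathcomp Require Import complex.
From mathcomp Require Import all_classical all_reals all_analysis.
From mathcomp Require Import ring lra.
From mathcomp Require cyclic separable cyclotomic polyrcf.

Import Order.TTheory GRing.Theory Num.Theory.
Import numFieldNormedType.Exports.

Local Open Scope classical_set_scope.
Local Open Scope ring_scope.
Local Open Scope complex_scope.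

(** * Positivity of polynomials, geometric sums and roots of unity *)

(** Serves in place of a limit: a strict inequality at the limit value of a parameter ([a = 1] or
    [t = 0] below) still holds for nearby values. *)
Lemma horner_gt0_near (F : rcfType) (p : {poly F}) x : 0 < p.[x] ->
  exists2 d, 0 < d & forall y, `|y - x| < d -> 0 < p.[y].
Proof.
move=> px; have [d d0 pd] := polyrcf.poly_cont x p px.
exists d => // y /pd; rewrite distrC ltr_norml => /andP[_]; lra.
Qed.

Lemma sum_expr_nat (F : fieldType) (q : F) m n : q != 1 -> (m <= n)%N ->
  \sum_(m <= k < n) q ^+ k = (q ^+ m - q ^+ n) / (1 - q).
Proof.
move=> q1; elim: n => [|n IH].
  by rewrite leqn0 => /eqP ->; rewrite big_geq// subrr mul0r.
rewrite leq_eqVlt => /predU1P[->|]; first by rewrite big_geq// subrr mul0r.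
rewrite ltnS => mn; rewrite big_nat_recr//= IH// exprS.
by field; rewrite subr_eq0 eq_sym.
Qed.

(** ['X^n - 1] is separable and splits, so it has [n] distinct roots, and among [n] distinct [n]-th
    roots of unity one is primitive. *)
Lemma prim_root_exists (C : numClosedFieldType) n : (0 < n)%N ->
  exists z : C, n.-primitive_root z.
Proof.
move=> n0; have [r Dr] := closed_field_poly_normal ('X^n - 1 : {poly C}).
rewrite (monicP (monicXnsubC _ n0)) scale1r in Dr.
have rs : (n <= size r)%N.
  by have := size_prod_XsubC r id; rewrite -Dr size_XnsubC// => -[<-].
have /hasP[z _ ?] : has n.-primitive_root r; last by exists z.
apply: cyclic.has_prim_root => //.
- by apply/allP => z; rewrite -root_prod_XsubC -Dr.
- rewrite -separable.separable_prod_XsubC -Dr.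
  by rewrite cyclotomic.separable_Xn_sub_1 ?pnatr_eq0 -?lt0n.
Qed.

Lemma norm_unity_root (C : numDomainType) n (z : C) : (0 < n)%N ->
  z ^+ n = 1 -> `|z| = 1.
Proof.
by move=> n0 z1; apply/eqP; rewrite -(@pexpr_eq1 _ _ n)// -normrX z1 normr1.
Qed.

(** Orthogonality of characters: conjugation inverts [w ^+ j], so the summands are powers of
    [u = w ^+ n / w ^+ m]. For [n != m], [u] is an [M]-th root of unity other than 1, whose powers
    sum to 0. *)
Lemma sum_expr_prim_root (C : numClosedFieldType) M (w : C) (n m : 'I_M) :
  M.-primitive_root w ->
  \sum_(j < M) (w ^+ j) ^+ n * ((w ^+ j) ^+ m)^*%R = (M%:R *+ (n == m)).
Proof.
move=> pw; have M0 := prim_order_gt0 pw; have wM := prim_expr_order pw.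
have w1 := norm_unity_root _ _ _ M0 wM.
have w0 : w != 0 by rewrite -normr_gt0 w1.
under eq_bigr => j _.
  rewrite !rmorphXn/= -!exprM -[w^*%R]mulr1 -[X in _ * (_ * X) ^+ _](mulfV w0).
  rewrite mulrA [_^*%R * w]mulrC -normCK w1 expr1n mul1r.
  rewrite exprVn mulnC [(j * m)%N]mulnC !exprM -exprVn -exprMn.
  over.
have [->|nm] := eqVneq n m.
  under eq_bigr do rewrite mulfV ?expf_neq0// expr1n.
  by rewrite sumr_const card_ord.
set u := w ^+ n / w ^+ m.
have uM : u ^+ M = 1.
  by rewrite exprMn exprVn -!exprM ![(_ * M)%N]mulnC !exprM wM !expr1n invr1 mulr1.
have u1 : u - 1 != 0.
  rewrite subr_eq0; apply: contra nm => /eqP u1.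
  have : w ^+ n == w ^+ m by rewrite -[w ^+ n](divfK (expf_neq0 m w0)) -/u u1 mul1r.
  by rewrite (eq_prim_root_expr pw) !modn_small.
by apply: (mulfI u1); rewrite mulr0 -subrX1 uM subrr.
Qed.

Lemma sum_exprS (F : fieldType) (q : F) m : q != 1 ->
  \sum_(i < m) q ^+ i.+1 = (q - q ^+ m.+1) / (1 - q).
Proof.
move=> q1; rewrite -(big_mkord xpredT (fun i => q ^+ i.+1)).
by rewrite -(big_add1 _ _ 0 m.+1 xpredT (fun i => q ^+ i)) sum_expr_nat// expr1.
Qed.

(** * Scalar inequalities and the equation defining the radius *)

Section RealBounds.
Context {R : realType}.
Implicit Types a p r x : R.

Lemma powR_le_tangent p x : 0 < p -> p <= 1 -> 0 <= x ->
  x `^ p <= 1 - p * (1 - x).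
Proof.
move=> p0 p1; rewrite le_eqVlt => /predU1P[<-|x0].
  by rewrite powR0 ?gt_eqF// subr0 mulr1 subr_ge0.
have xE : x = expR (ln x) by rewrite lnK.
rewrite /powR gt_eqF//; set u := ln x in xE *; rewrite xE.
have e0 := expR_gt0 (p * u).
have -> : expR u = expR (p * u) * expR ((1 - p) * u).
  by rewrite -expRD; congr expR; ring.
have e1 : expR (p * u) * expR (- (p * u)) = 1 by rewrite -expRD subrr expR0.
(* Average [1 + y <= expR y] at [(1 - p) * u] and [- p * u] with weights [p]
   and [1 - p]. *)
have le1 := expR_ge1Dx ((1 - p) * u); have le2 := expR_ge1Dx (- (p * u)).
have : 1 <= p * expR ((1 - p) * u) + (1 - p) * expR (- (p * u)).
  have := ler_wpM2l (ltW p0) le1.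
  have : 0 <= 1 - p by rewrite subr_ge0.
  by move=> /ler_wpM2l /(_ _ _ le2); lra.
move=> /(ler_wpM2l (ltW e0)); rewrite mulr1 mulrDr.
rewrite [expR (p * u) * ((1 - p) * _)]mulrCA e1; lra.
Qed.

Lemma powR_ge_tangentV p x : 0 <= p -> 0 < x -> 1 - p * (1 - x) / x <= x `^ p.
Proof.
move=> p0 x0; rewrite /powR gt_eqF//; apply: le_trans (expR_ge1Dx _).
rewrite lerD2l -mulrA -mulrN ler_wpM2l//.
have := expR_ge1Dx (- ln x); rewrite expRN lnK//.
by rewrite mulrBl mul1r divff ?gt_eqF//; lra.
Qed.

Definition bohr_fun p N x : R := 2 * (1 + x) * x ^+ N - p * (1 - x) ^+ 2.

(** Yields the uniqueness of the root and the sign of [bohr_fun] on either side of it. *)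
Lemma bohr_fun_lt p N x y : 0 < p -> (0 < N)%N -> 0 <= x -> x < y -> y <= 1 ->
  bohr_fun p N x < bohr_fun p N y.
Proof.
move=> p0 N0 x0 xy y1; have y0 := le_lt_trans x0 xy.
apply: ltr_leB.
  apply: (@lt_le_trans _ _ (2 * (1 + x) * y ^+ N)).
    by rewrite ltr_pM2l ?ltrXn2r -?lt0n//; lra.
  by rewrite ler_wpM2r ?exprn_ge0//; lra.
by rewrite ler_pM2l//; nra.
Qed.

Lemma bohr_root_exists p N : 0 < p -> (0 < N)%N ->
  exists2 x, 0 < x < 1 & bohr_fun p N x = 0.
Proof.
move=> p0 N0.
pose q : {poly R} := 2%:P * (1 + 'X) * 'X ^+ N - p%:P * (1 - 'X) ^+ 2.
have qE x : q.[x] = bohr_fun p N x by rewrite /q ?/bohr_fun !hornerE.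
have q0 : q.[0] < 0 by rewrite qE /bohr_fun expr0n gtn_eqF//= mulr0; lra.
have q1 : 0 < q.[1] by rewrite qE /bohr_fun expr1n; lra.
have [|x /andP[x0 x1] /rootP qx] := @poly_ivt R q 0 1 ler01.
  by rewrite (ltW q0) (ltW q1).
exists x; last by rewrite -qE.
rewrite !lt_neqAle x0 x1 !andbT; apply/andP; split.
  by apply/eqP => x_0; rewrite -x_0 in qx; rewrite qx ltxx in q0.
by apply/eqP => x_1; rewrite x_1 in qx; rewrite qx ltxx in q1.
Qed.

Lemma bohr_bound p N a r : 0 < p -> p <= 1 -> 0 <= a -> a < 1 -> 0 <= r -> r < 1 ->
  bohr_fun p N r <= 0 ->
  ((a + r) / (1 + a * r)) `^ p + (1 - a ^+ 2) * (r ^+ N / (1 - r)) <= 1.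
Proof.
move=> p0 p1 a0 a1 r0 r1; rewrite subr_le0 => le.
have ar : 0 < 1 + a * r by rewrite ltr_wpDr// mulr_ge0.
have X0 : 0 <= (a + r) / (1 + a * r) by rewrite divr_ge0 ?addr_ge0// mulr_ge0.
apply: le_trans (lerD (powR_le_tangent _ _ p0 p1 X0) (lexx _)) _.
have rN := exprn_ge0 N r0.
rewrite -addrA gerDl addrC subr_le0.
(* Both sides carry the nonnegative factor [(1 - a) / ((1 + a * r) * (1 - r))]; removing it leaves
   [(1 + a) * (1 + a * r) * r ^+ N <= p * (1 - r) ^+ 2]. *)
have -> : p * (1 - (a + r) / (1 + a * r)) =
    p * (1 - r) ^+ 2 * ((1 - a) / ((1 + a * r) * (1 - r))).
  by field; rewrite !gt_eqF ?subr_gt0.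
have -> : (1 - a ^+ 2) * (r ^+ N / (1 - r)) =
    (1 + a) * (1 + a * r) * r ^+ N * ((1 - a) / ((1 + a * r) * (1 - r))).
  by field; rewrite !gt_eqF ?subr_gt0.
apply: ler_wpM2r.
  by rewrite divr_ge0 ?mulr_ge0 ?subr_ge0// ltW.
apply: le_trans le; apply: ler_wpM2r => //.
by apply: ler_pM; rewrite ?addr_ge0 ?mulr_ge0//; nra.
Qed.

(** The sum in the conclusion belongs to (a - z) / (1 - a z) at z = -r: its coefficients have
    modulus (1 - a^2) a^(k-1) for k >= 1, which makes the tail geometric. *)
Lemma bohr_sharp p N r : 0 < p -> (0 < N)%N -> 0 <= r -> r < 1 ->
  0 < bohr_fun p N r -> exists2 a, 0 < a < 1 &
  1 < ((a + r) / (1 + a * r)) `^ p + (1 - a ^+ 2) * a ^+ N.-1 * r ^+ N / (1 - a * r).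
Proof.
move=> p0 N0 r0 r1 Br.
(* After [powR_ge_tangentV] and removal of the factor [(1 - a) / ((a + r) * (1 - a * r))] the goal
   is [0 < q.[a]], and [q.[1] = bohr_fun p N r]. *)
pose q : {poly R} := (1 + 'X) * 'X ^+ N.-1 * (r ^+ N)%:P * ('X + r%:P)
  - p%:P * (1 - r)%:P * (1 - 'X * r%:P).
have qE x : q.[x] = (1 + x) * x ^+ N.-1 * r ^+ N * (x + r) - p * (1 - r) * (1 - x * r).
  by rewrite /q ?/bohr_fun !hornerE.
have [|d d0 dq] := @horner_gt0_near R q 1.
  by rewrite qE expr1n; move: Br; rewrite /bohr_fun; lra.
(* The first bound puts [a] within [d] of 1, the second keeps it positive. *)
pose a := 1 - Num.min (d / 2) (1 / 2).
have [a0 a1 ad] : [/\ 0 < a, a < 1 & `|a - 1| < d].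
  rewrite /a addrAC subrr add0r normrN.
  have : 0 < Num.min (d / 2) (1 / 2) by rewrite lt_min !divr_gt0.
  move=> m0; rewrite gtr0_norm//.
  have : Num.min (d / 2) (1 / 2) <= d / 2 by rewrite ge_min lexx.
  have : Num.min (d / 2) (1 / 2) <= 1 / 2 by rewrite ge_min lexx orbT.
  by move=> *; split; lra.
exists a; first by rewrite a0 a1.
have := dq a ad; rewrite qE subr_gt0 => lt.
have ar : 0 < 1 + a * r by rewrite ltr_wpDr// mulr_ge0// ltW.
have ar' : 0 < 1 - a * r by nra.
have ar2 : 0 < a + r by rewrite ltr_wpDr.
have X0 : 0 < (a + r) / (1 + a * r) by rewrite divr_gt0.
apply: lt_le_trans (lerD (powR_ge_tangentV _ _ (ltW p0) X0) (lexx _)).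
rewrite -addrA ltrDl addrC subr_gt0.
have -> : p * (1 - (a + r) / (1 + a * r)) / ((a + r) / (1 + a * r)) =
    p * (1 - r) * (1 - a * r) * ((1 - a) / ((a + r) * (1 - a * r))).
  by field; rewrite !gt_eqF.
have -> : (1 - a ^+ 2) * a ^+ N.-1 * r ^+ N / (1 - a * r) =
    (1 + a) * a ^+ N.-1 * r ^+ N * (a + r) * ((1 - a) / ((a + r) * (1 - a * r))).
  by field; rewrite !gt_eqF.
by rewrite ltr_pM2r// divr_gt0 ?mulr_gt0// subr_gt0.
Qed.

End RealBounds.

(** * Parseval over roots of unity and truncations of the expansion *)

Section Hilbert.
Context {R : realType} {H : hilbertType R}.
Implicit Types (x y : H) (A : boundedOp H).

(** Once the squared norms are expanded as inner products, orthogonality of characters leaves only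
    the diagonal terms. *)
Lemma parseval_unity_roots M (w : R[i]) (D : nat -> H) : M.-primitive_root w ->
  \sum_(j < M) `|\sum_(n < M) (w ^+ j) ^+ n *: D n| ^+ 2 =
  M%:R * \sum_(n < M) `|D n| ^+ 2.
Proof.
move=> pw.
transitivity (\sum_(n < M) \sum_(m < M) \sum_(j < M)
    (w ^+ j) ^+ n * ((w ^+ j) ^+ m)^*%R * inner (D n) (D m)).
  under [RHS]eq_bigr => n _ do rewrite exchange_big/=.
  rewrite [RHS]exchange_big/=; apply: eq_bigr => j _.
  rewrite sqr_normE linear_sumlz; apply: eq_bigr => n _.
  rewrite linear_sumr; apply: eq_bigr => m _.
  by rewrite linearZl_LR linearZr_LR/= mulrA.
rewrite mulr_sumr; apply: eq_bigr => n _.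
under eq_bigr do rewrite -mulr_suml sum_expr_prim_root//.
rewrite (bigD1 n)//= big1 ?addr0 => [|m mn].
  by rewrite eqxx mulr1n sqr_normE.
by rewrite eq_sym (negPf mn) mulr0n mul0r.
Qed.

HB.instance Definition _ A :=
  GRing.isLinear.Build R[i] H H *:%R (op_fun A) (op_linear A).

Lemma op_sumE I (r : seq I) (P : pred I) (F : I -> boundedOp H) x :
  (\sum_(i <- r | P i) F i) x = \sum_(i <- r | P i) F i x.
Proof. exact: (big_morph (fun B : boundedOp H => B x)). Qed.

(** The convolution on the left is the coefficient of u^n in the product of the operator polynomial
    by the vector polynomial with coefficients [v j]. The pointwise bound [c] at [rho] times the
    roots of unity becomes a bound on coefficients by Parseval. The order [m + L] exceeds the degree
    of the product, so no coefficients are mixed. *)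
Lemma conv_contraction_radius (A : nat -> boundedOp H) (v : nat -> H) m L
    (rho c : R[i]) : (m <= L)%N -> 0 <= rho -> 0 <= c ->
  (forall w : R[i], `|w| = rho -> forall x,
     `|\sum_(k < L) w ^+ k *: A k x| <= c * `|x|) ->
  \sum_(n < m) rho ^+ n.*2 * `|\sum_(j < m | (j <= n)%N) A (n - j)%N (v j)| ^+ 2
    <= c ^+ 2 * \sum_(j < m) rho ^+ j.*2 * `|v j| ^+ 2.
Proof.
move=> mL rho0 c0 cA.
have [->|m0] := posnP m; first by rewrite !big_ord0 mulr0.
have M0 : (0 < m + L)%N by rewrite addn_gt0 m0.
have [w pw] := prim_root_exists R[i] _ M0.
(* [F] collects all the coefficients of the product; [D] pads [v] with zeros so that both Parseval
   identities use the same roots of unity. *)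
pose F n := \sum_(k < L) \sum_(j < m | (k + j)%N == n) A k (v j).
pose D n := if (n < m)%N then v n else 0.
have normD2 n x : `|rho ^+ n *: x| ^+ 2 = rho ^+ n.*2 * `|x| ^+ 2.
  by rewrite normrZ normrX (ger0_norm rho0) exprMn -exprM muln2.
have FE (n : 'I_m) : F n = \sum_(j < m | (j <= n)%N) A (n - j)%N (v j).
  rewrite /F (exchange_big_dep xpredT)//= [RHS]big_mkcond/=.
  apply: eq_bigr => j _; case: leqP => jn.
    have nL : (n - j < L)%N by rewrite (leq_ltn_trans (leq_subr _ _))// (leq_trans _ mL).
    rewrite (big_pred1 (Ordinal nL))//= => k.
    by rewrite /= -[RHS]/(nat_of_ord k == n - j)%N -(eqn_add2r j (k : nat)) subnK.
  by rewrite big_pred0// => k; apply/negbTE; rewrite neq_ltn (leq_trans jn) ?leq_addl ?orbT.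
have DE u : \sum_(n < m + L) u ^+ n *: (rho ^+ n *: D n) =
    \sum_(j < m) (u * rho) ^+ j *: v j.
  rewrite big_split_ord/= [X in _ + X]big1 ?addr0 => [|i _].
    by apply: eq_bigr => j _; rewrite /D ltn_ord scalerA exprMn.
  by rewrite /D ltnNge leq_addr/= !scaler0.
have FDE u : \sum_(n < m + L) u ^+ n *: (rho ^+ n *: F n) =
    \sum_(k < L) (u * rho) ^+ k *: A k (\sum_(n < m + L) u ^+ n *: (rho ^+ n *: D n)).
  rewrite DE.
  under eq_bigr => n _ do rewrite scalerA -exprMn /F scaler_sumr.
  rewrite exchange_big/=; apply: eq_bigr => k _.
  under eq_bigr => n _ do rewrite scaler_sumr.
  rewrite linear_sum/= scaler_sumr (exchange_big_dep xpredT)//=.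
  apply: eq_bigr => j _; rewrite linearZ/= scalerA -exprD.
  have kj : (k + j < m + L)%N by rewrite addnC -addSn leq_add// ltnW.
  by rewrite (big_pred1 (Ordinal kj)).
have := parseval_unity_roots _ _ (fun n => rho ^+ n *: F n) pw.
have := parseval_unity_roots _ _ (fun n => rho ^+ n *: D n) pw.
set PD := \sum_(j < _) _ => PDE; set PF := \sum_(j < _) _ => PFE.
have w1 := norm_unity_root _ _ _ M0 (prim_expr_order pw).
have le1 : PF <= c ^+ 2 * PD.
  rewrite mulr_sumr; apply: ler_sum => j _.
  have le2 := cA (w ^+ j * rho) _ (\sum_(n < m + L) (w ^+ j) ^+ n *: (rho ^+ n *: D n)).
  rewrite FDE -exprMn lerXn2r ?nnegrE ?le2//.
    by rewrite (le_trans _ (le2 _)) ?normrM ?normrX ?w1 ?expr1n ?mul1r ?(ger0_norm rho0).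
  by rewrite normrM normrX w1 expr1n mul1r (ger0_norm rho0).
move: le1; rewrite PDE PFE mulrCA ler_pM2l ?ltr0n// => le1.
apply: le_trans (le_trans le1 _); last first.
  rewrite big_split_ord/= [X in _ + X]big1 ?addr0 => [|i _].
    by rewrite ler_wpM2l ?exprn_ge0//; apply: ler_sum => j _; rewrite normD2 /D ltn_ord.
  by rewrite /D ltnNge leq_addr/= scaler0 normr0 expr0n.
(* The coefficients of index at least [m] contribute nonnegative terms and are dropped. *)
rewrite big_split_ord/= -[leLHS]addr0 lerD//; last first.
  by apply: sumr_ge0 => i _; rewrite exprn_ge0.
by apply: ler_sum => j _; rewrite normD2 FE.
Qed.

Lemma power_expansion_near (f : R[i]^o -> boundedOp H) (A : nat -> boundedOp H)
    (z : R[i]^o) (e : R) :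
  power_expansion_on_disk f A -> `|z| < 1 -> 0 < e ->
  \forall n \near \oo, opnorm (f z - \sum_(k < n) z ^+ k *: A k) <= e.
Proof.
move=> fA z1 e0; have /cvgrPdist_le /(_ e%:C) := fA _ z1.
rewrite ltcR => /(_ e0); apply: filterS => n.
by rewrite /series/= big_mkord normopE lecR.
Qed.

Lemma near_coef_le1 (f : R[i]^o -> boundedOp H) (A : nat -> boundedOp H) (s : R) :
  power_expansion_on_disk f A -> 0 <= s < 1 ->
  \forall k \near \oo, s ^+ k * opnorm (A k) <= 1.
Proof.
move=> fA /andP[s0 s1]; have s1C : `|s%:C : R[i]^o| < 1.
  by rewrite ger0_norm ?ltcR// lecR.
have /cvgrPdist_le /(_ 1 ltr01) : (fun k => (s%:C : R[i]^o) ^+ k *: A k) @ \oo --> 0.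
  by apply: cvg_series_cvg_0; apply/cvg_ex; exists (f s%:C); exact: fA.
apply: filterS => k; rewrite sub0r normrN normrZ normrX ger0_norm ?lecR//.
by rewrite normopE -rmorphXn -rmorphM lecR.
Qed.

(** For [rho < s < 1] the bound [s ^+ k * opnorm (A k) <= 1], valid for large [k], dominates the
    tail on the circle of radius [rho] by a geometric series of ratio [q = rho / s], uniformly in
    [w]. *)
Lemma norm_trunc_le (f : R[i]^o -> boundedOp H) (A : nat -> boundedOp H)
    (rho e : R) m :
  power_expansion_on_disk f A ->
  (forall z : R[i]^o, `|z| < 1 -> opnorm (f z) <= 1) ->
  0 < rho < 1 -> 0 < e ->
  exists2 L, (m <= L)%N & forall w : R[i], `|w| = rho%:C -> forall x,
    `|\sum_(k < L) w ^+ k *: A k x| <= (1 + e)%:C * `|x|.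
Proof.
move=> fA f1 /andP[rho0 rho1] e0.
pose s := (1 + rho) / 2; have s0 : 0 < s by rewrite /s; lra.
have s1 : s < 1 by rewrite /s; lra.
pose q := rho / s; have q0 : 0 < q by rewrite divr_gt0.
have q1 : q < 1 by rewrite ltr_pdivrMr// /s; lra.
have e20 : 0 < e / 2 by rewrite divr_gt0.
have [L] : exists L, [/\ (m <= L)%N, forall k, (L <= k)%N -> s ^+ k * opnorm (A k) <= 1
    & q ^+ L / (1 - q) <= e / 2].
  have : q ^+ n @[n --> \oo] --> (0 : R) by apply: cvg_expr; rewrite ger0_norm ?ltW.
  move=> /cvgrPdist_le /(_ (e / 2 * (1 - q))).
  rewrite mulr_gt0 ?subr_gt0// => /(_ isT) [N1 _ N1P].
  have [|N2 _ N2P] := @near_coef_le1 f A s fA; first by rewrite s1 ltW.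
  exists (maxn m (maxn N1 N2)); split; first by rewrite leq_maxl.
    by move=> k; rewrite !geq_max => /and3P[_ _ ?]; exact: N2P.
  rewrite ler_pdivrMr ?subr_gt0//.
  have : (N1 <= maxn m (maxn N1 N2))%N by rewrite leq_max leq_maxl orbT.
  by move=> /N1P/=; rewrite sub0r normrN (ger0_norm (exprn_ge0 _ (ltW q0))).
move=> [mL AL qL]; exists L => // w wrho x.
have w1 : `|w : R[i]^o| < 1 by rewrite wrho ltcR.
(* [N] depends on [w] but [L] must not: [f w] is compared with a possibly longer partial sum, and
   the block from [L] to [n] is covered by the uniform tail bound. *)
have [N _ /(_ _ (leq_maxl N L))] := power_expansion_near f A w _ fA w1 e20.
rewrite /= => fN.
have -> : \sum_(k < L) w ^+ k *: A k x = (\sum_(k < L) w ^+ k *: A k) x.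
  by rewrite op_sumE.
rewrite (le_trans (le_opnorm _ _))// ler_wpM2r// -normopE.
set n := maxn N L in fN; have Ln : (L <= n)%N by rewrite leq_maxr.
have -> : \sum_(k < L) w ^+ k *: A k =
    f w - (f w - \sum_(k < n) w ^+ k *: A k) - \sum_(L <= k < n) w ^+ k *: A k.
  rewrite -!(big_mkord xpredT (fun k => w ^+ k *: A k)) (big_cat_nat _ Ln)//=.
  by rewrite opprB addrCA subrr addr0 addrK.
have tail : `|\sum_(L <= k < n) w ^+ k *: A k| <= (e / 2)%:C.
  rewrite (le_trans (ler_norm_sum _ _ _))//.
  apply: le_trans (_ : (\sum_(L <= k < n) q ^+ k)%:C <= _); last first.
    rewrite lecR; apply: le_trans qL.
    rewrite sum_expr_nat ?lt_eqF//.
    apply: ler_wpM2r; first by rewrite invr_ge0 subr_ge0 ltW.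
    by rewrite lerBlDr lerDl exprn_ge0// ltW.
  rewrite rmorph_sum/= big_nat [leRHS]big_nat; apply: ler_sum => k /andP[Lk _].
  rewrite normrZ normrX wrho normopE -rmorphXn -rmorphM lecR.
  have -> : rho = q * s by rewrite divfK ?gt_eqF.
  by rewrite exprMn -mulrA ler_piMr ?exprn_ge0 ?(ltW q0) ?AL.
have -> : 1 + e = 1 + e / 2 + e / 2 by lra.
rewrite !rmorphD/= (le_trans (ler_normB _ _))// lerD//.
rewrite (le_trans (ler_normB _ _))// lerD//; rewrite normopE lecR//.
exact: f1.
Qed.

(** * Real-valued norms and contractivity of the Toeplitz matrices *)

(** The norm of [H] lies in [R[i]], whose order is only partial; the real version admits real
    limits, [lra] and [nra]. *)
Definition rnorm x : R := complex.Re `|x|.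

Lemma rnormE x : (rnorm x)%:C = `|x|.
Proof. by rewrite RRe_real ?normr_real. Qed.

Lemma rnorm_ge0 x : 0 <= rnorm x.
Proof. by rewrite -ler0c rnormE. Qed.

Lemma rnorm0 : rnorm 0 = 0.
Proof. by apply: complexI; rewrite rnormE normr0. Qed.

Lemma rnormD x y : rnorm (x + y) <= rnorm x + rnorm y.
Proof. by rewrite -lecR rmorphD/= !rnormE ler_normD. Qed.

Lemma rnormN x : rnorm (- x) = rnorm x.
Proof. by rewrite /rnorm normrN. Qed.

Lemma ler_rnorm_dist x y : `|rnorm x - rnorm y| <= rnorm (x - y).
Proof.
have le u v : rnorm u - rnorm v <= rnorm (u - v).
  by rewrite lerBlDr -{1}(subrK v u) rnormD.
by rewrite ler_norml le lerNl opprB -(rnormN (x - y)) opprB le.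
Qed.

(** [conv_contraction_radius] is used with [rho = 1 - t] and [c = 1 + t] for small [t]. A failure of
    the inequality at [t = 0] would persist for some [t > 0]. *)
Lemma conv_contraction (f : R[i]^o -> boundedOp H) (A : nat -> boundedOp H)
    (v : nat -> H) m :
  power_expansion_on_disk f A ->
  (forall z : R[i]^o, `|z| < 1 -> opnorm (f z) <= 1) ->
  \sum_(n < m) rnorm (\sum_(j < m | (j <= n)%N) A (n - j)%N (v j)) ^+ 2
    <= \sum_(j < m) rnorm (v j) ^+ 2.
Proof.
move=> fA f1.
rewrite leNgt; apply/negP; set sb := \sum_(j < m) _; set sa := \sum_(n < m) _ => sba.
have sb0 : 0 <= sb by apply: sumr_ge0 => i _; rewrite exprn_ge0 ?rnorm_ge0.
(* On the left every weight [rho ^+ n.*2] with [n < m] is at least [(1 - t) ^+ m.*2]; on the right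
   the weights are at most 1. *)
pose p : {poly R} := (1 - 'X) ^+ m.*2 * sa%:P - (1 + 'X) ^+ 2 * sb%:P.
have pE t : p.[t] = (1 - t) ^+ m.*2 * sa - (1 + t) ^+ 2 * sb by rewrite /p !hornerE.
have [|d d0 dp] := @horner_gt0_near _ p 0.
  by rewrite pE subr0 addr0 !expr1n !mul1r subr_gt0.
pose t := Num.min (d / 2) (1 / 2).
have t0 : 0 < t by rewrite lt_min !divr_gt0.
have t1 : t < 1 by rewrite gt_min; apply/orP; right; lra.
have td : t < d by rewrite gt_min; apply/orP; left; lra.
have := dp t; rewrite subr0 ger0_norm ?(ltW t0)// => /(_ td).
rewrite pE ltNge => /negP; apply; rewrite subr_le0.
have t01 : 0 < 1 - t < 1 by apply/andP; split; lra.
have [L mL AL] := norm_trunc_le f A (1 - t) t m fA f1 t01 t0.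
have t1C : 0 <= (1 - t)%:C :> R[i] by rewrite lecR subr_ge0 ltW.
have tC : 0 <= (1 + t)%:C :> R[i] by rewrite lecR addr_ge0 ?ltW.
have := conv_contraction_radius A v _ _ _ _ mL t1C tC AL.
under eq_bigr 
  do rewrite -rnormE -!(rmorphXn (real_complex R)) -(rmorphM (real_complex R)).
under [X in _ <= _ * X]eq_bigr 
  do rewrite -rnormE -!(rmorphXn (real_complex R)) -(rmorphM (real_complex R)).
rewrite -!(rmorph_sum (real_complex R)) -(rmorphXn (real_complex R)).
rewrite -(rmorphM (real_complex R)) lecR => le.
apply: le_trans (le_trans le _).
  rewrite mulr_sumr; apply: ler_sum => n _; rewrite ler_wpM2r ?exprn_ge0 ?rnorm_ge0//.
  by rewrite ler_wiXn2l ?leq_double 1?ltnW//; lra.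
rewrite ler_wpM2l ?sqr_ge0//; apply: ler_sum => j _.
by rewrite ler_piMl ?exprn_ge0 ?rnorm_ge0// exprn_ile1//; lra.
Qed.

Lemma le_rnorm_op A x : rnorm (A x) <= opnorm A * rnorm x.
Proof. by rewrite -lecR rmorphM/= !rnormE le_opnorm. Qed.

Lemma rnorm_opnorm_le A (M : R) : 0 <= M ->
  (forall x, rnorm (A x) <= M * rnorm x) -> opnorm A <= M.
Proof.
by move=> M0 AM; apply: opnorm_le => // x; rewrite -!rnormE -rmorphM lecR.
Qed.

Lemma rnormZ (a : R[i]) x : rnorm (a *: x) = complex.Re `|a| * rnorm x.
Proof.
apply: complexI; rewrite (rmorphM (real_complex R)) rnormE normrZ.
congr (_ * _); last exact/esym/rnormE.
Qed.

(** Evaluates the quadratic form of the Schwarz-Pick argument at its optimal perturbation, where the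
    gain is [c * rnorm v ^+ 2]. *)
Lemma rnorm_complete_square (a : R[i]) (b c : R) x y :
  `|a| = b%:C -> c * (1 - b ^+ 2) = 1 ->
  let v := y - a^*%R *: x in
  rnorm (x - (c%:C * a) *: v) ^+ 2 - rnorm (y - c%:C *: v) ^+ 2 =
  rnorm x ^+ 2 - rnorm y ^+ 2 + c * rnorm v ^+ 2.
Proof.
move=> ab + v => /(congr1 (real_complex R)) cE; apply: complexI; move: cE.
rewrite !(rmorphB, rmorphD, rmorphM, rmorphXn, rmorph1)/= -!expr2 -ab.
rewrite !rnormE !sqr_normE normCK => cE.
have cc : (c%:C)^*%R = c%:C :> R[i] by apply/CrealP; apply/complex_realP; exists c.
apply: subr0_eq.
(* The two sides differ by a multiple of [1 - c * (1 - b ^+ 2)], which vanishes. *)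
transitivity (c%:C * inner v v * (1 - c%:C * (1 - a * a^*%R))); last first.
  by rewrite cE subrr mulr0.
have scaleE (u w : R[i]) : u *: (w : R[i]^o) = u * w by [].
rewrite /v !(linearBl, linearBr)/= !(linearZl_LR, linearZr_LR)/= !(linearBl, linearBr)/=.
rewrite !(linearZl_LR, linearZr_LR)/= !rmorphM/= !conjCK cc !scaleE.
ring.
Qed.

(** * The bound on the coefficients *)

Lemma coef_bound (f : R[i]^o -> boundedOp H) (A : nat -> boundedOp H)
    (a0 : R[i]) (a : R) k :
  power_expansion_on_disk f A ->
  (forall z : R[i]^o, `|z| < 1 -> opnorm (f z) <= 1) ->
  `|a0| = a%:C -> a < 1 -> A 0%N = a0 *: id_op H -> (0 < k)%N ->
  opnorm (A k) <= 1 - a ^+ 2.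
Proof.
move=> fA f1 aE a_lt1 A0; case: k => // k _.
have a0_ge0 : 0 <= a by rewrite -ler0c -aE.
have a2 : 0 < 1 - a ^+ 2 by rewrite subr_gt0 exprn_ilt1.
apply: rnorm_opnorm_le => [|x]; first exact: ltW.
(* This multiple of [A k.+1 x] makes the contraction inequality sharpest. *)
pose y := ((1 - a ^+ 2)^-1%:C * a0^*%R) *: A k.+1 x.
pose v j := if j == 0%N then x else if j == k.+1 then y else 0.
have := conv_contraction f A v k.+2 fA f1.
have -> : \sum_(j < k.+2) rnorm (v j) ^+ 2 = rnorm x ^+ 2 + rnorm y ^+ 2.
  rewrite big_ord_recl big_ord_recr/= big1 ?add0r => [|i _].
    by rewrite /v /bump/= eqxx.
  by rewrite /v /bump/= add1n eqSS ltn_eqF// rnorm0 expr0n.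
set F := fun n : nat => \sum_(j < k.+2 | (j <= n)%N) A (n - j)%N (v j).
have F0 : F 0%N = a0 *: x.
  by rewrite /F big_mkcond big_ord_recl big1//= addr0 subn0 A0.
have Fk : F k.+1 = A k.+1 x + a0 *: y.
  rewrite /F big_mkcond big_ord_recl big_ord_recr/= big1 ?add0r => [|i _].
    by rewrite /v /bump/= add1n leqnn eqxx subnn A0.
  by rewrite /v /bump/= add1n eqSS [_ == _]ltn_eqF// linear0 if_same.
(* Only rows 0 and [k.+1] of the matrix are kept. *)
move=> le; have {le} : rnorm (F 0%N) ^+ 2 + rnorm (F k.+1) ^+ 2 <=
    rnorm x ^+ 2 + rnorm y ^+ 2.
  apply: le_trans le; rewrite big_ord_recl big_ord_recr/= lerD2l lerDr.
  by apply: sumr_ge0 => i _; rewrite exprn_ge0// rnorm_ge0.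
have -> : F k.+1 = (1 - a ^+ 2)^-1%:C *: A k.+1 x.
  rewrite Fk /y scalerA -[X in X + _]scale1r -scalerDl; congr (_ *: _).
  transitivity ((1 + (1 - a ^+ 2)^-1 * a ^+ 2)%:C).
    by rewrite mulrCA -normCK aE (rmorphD (real_complex R)) rmorphM rmorphXn.
  by congr (_%:C); field; rewrite gt_eqF.
have c0 : 0 <= (1 - a ^+ 2)^-1 by rewrite invr_ge0 ltW.
rewrite F0 /y !rnormZ normrM norm_conjC aE !ger0_norm ?lecR//.
rewrite -(rmorphM (real_complex R))/=.
set X := rnorm x; set Y := rnorm (A k.+1 x) => le.
(* With [c = (1 - a ^+ 2)^-1] the hypothesis reads a^2 X^2 + c^2 Y^2 <= X^2 + c^2 a^2 Y^2, that is,
   c^2 Y^2 <= X^2 after division by 1 - a^2. *)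
suff : (1 - a ^+ 2)^-1 * Y <= X by rewrite mulrC ler_pdivrMr// mulrC.
rewrite -(@ler_sqr R) ?nnegrE ?mulr_ge0 ?rnorm_ge0//.
rewrite -(ler_pM2l a2); move: le; rewrite -/X -/Y; nra.
Qed.

(** * The Schwarz-Pick bound *)

Lemma rnorm_expansion_cvg (f : R[i]^o -> boundedOp H) (A : nat -> boundedOp H)
    (z : R[i]^o) x y :
  power_expansion_on_disk f A -> `|z| < 1 ->
  rnorm ((\sum_(k < n) z ^+ k *: A k) y + x) @[n --> \oo] --> rnorm (f z y + x).
Proof.
move=> fA z1; apply/cvgrPdist_le => e e0.
(* Adding 1 keeps the denominator positive when [y = 0]. *)
have d0 : 0 < e / (rnorm y + 1) by rewrite divr_gt0// ltr_wpDl// rnorm_ge0.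
have := power_expansion_near f A z _ fA z1 d0; apply: filterS => n.
set S := \sum_(k < n) _ => Sle.
apply: le_trans (ler_rnorm_dist _ _) _.
rewrite opprD addrACA subrr addr0 -[X in rnorm X]/((f z - S) y) (le_trans (le_rnorm_op _ _))//.
rewrite (le_trans (ler_wpM2r (rnorm_ge0 _) Sle))//.
rewrite mulrAC ler_pdivrMr ?ltr_wpDl ?rnorm_ge0// ler_pM2l//.
by rewrite lerDl.
Qed.

Lemma rnormZX (z : R[i]) (r : R) k x : `|z| = r%:C ->
  rnorm (z ^+ k *: x) = r ^+ k * rnorm x.
Proof. by move=> zr; rewrite rnormZ normrX zr -rmorphXn. Qed.

(** On the vectors [z ^+ (m - j) *: y], row [n < m] of the Toeplitz matrix gives
    [z ^+ (m - n) *: S n.+1 y]. The perturbation [x] at [j = m] enters only the last row, through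
    [A 0]. *)
Lemma schwarz_pick_trunc (f : R[i]^o -> boundedOp H) (A : nat -> boundedOp H)
    (z : R[i]) (r : R) x y m :
  power_expansion_on_disk f A ->
  (forall z : R[i]^o, `|z| < 1 -> opnorm (f z) <= 1) ->
  `|z| = r%:C -> r < 1 ->
  let S n : boundedOp H := \sum_(k < n) z ^+ k *: A k in
  (rnorm (S m.+1 y + A 0%N x) ^+ 2 +
    \sum_(i < m) (r ^+ 2) ^+ i.+1 * rnorm (S (m - i)%N y) ^+ 2 <=
  rnorm (y + x) ^+ 2 + r ^+ 2 / (1 - r ^+ 2) * rnorm y ^+ 2 : Prop).
Proof.
move=> fA f1 zr r1 S; have r0 : 0 <= r by rewrite -ler0c -zr.
have r21 : r ^+ 2 < 1 by rewrite exprn_ilt1.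
pose v j := if j == m then y + x else z ^+ (m - j) *: y.
have vE j : (j < m)%N -> v j = z ^+ (m - j) *: y.
  by move=> jm; rewrite /v ltn_eqF.
have SE n u : S n u = \sum_(k < n) z ^+ k *: A k u by rewrite op_sumE.
have vsum : \sum_(j < m.+1) rnorm (v j) ^+ 2 <=
    rnorm (y + x) ^+ 2 + r ^+ 2 / (1 - r ^+ 2) * rnorm y ^+ 2.
  (* Reversing the order puts the perturbed vector first; the others form a geometric sum. *)
  rewrite (reindex_inj rev_ord_inj)/= big_ord_recl/= subSS subn0 {1}/v eqxx lerD2l.
  under eq_bigr => i _.
    rewrite /bump/= add1n subSS vE; last by rewrite ltn_subrL (leq_trans _ (ltn_ord i)).
    rewrite subKn// (rnormZX _ r)// exprMn -exprM mulnC exprM.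
    over.
  rewrite -mulr_suml ler_wpM2r ?sqr_ge0// sum_exprS ?lt_eqF//.
  apply: ler_wpM2r; first by rewrite invr_ge0 subr_ge0 ltW.
  by rewrite lerBlDr lerDl exprn_ge0// sqr_ge0.
apply: le_trans vsum; apply: le_trans (conv_contraction f A v m.+1 fA f1).
rewrite [leRHS](reindex_inj rev_ord_inj)/= big_ord_recl/= subSS subn0.
have -> : S m.+1 y + A 0%N x = \sum_(j < m.+1 | (j <= m)%N) A (m - j)%N (v j).
  under [RHS]eq_bigl do rewrite -ltnS ltn_ord.
  rewrite big_ord_recr/= subnn {2}/v eqxx linearD addrA; congr (_ + _).
  rewrite SE big_ord_recl expr0 scale1r addrC; congr (_ + _).
  rewrite [RHS](reindex_inj rev_ord_inj)/=; apply: eq_bigr => j _.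
  by rewrite vE ?ltn_subrL ?(leq_trans _ (ltn_ord j))// subKn// linearZ.
rewrite lerD2l; apply: ler_sum => i _.
rewrite /bump/= add1n subSS; set n := (m - i.+1)%N.
have nm : (n < m)%N by rewrite ltn_subrL (leq_trans _ (ltn_ord i)).
have -> : \sum_(j < m.+1 | (j <= n)%N) A (n - j)%N (v j) = z ^+ i.+1 *: S (m - i)%N y.
  have -> : (m - i)%N = n.+1 by rewrite /n subnS prednK// subn_gt0.
  rewrite -(big_ord_widen m.+1 (fun j => A (n - j)%N (v j)) (ltnW nm : (n.+1 <= m.+1)%N)).
  rewrite (reindex_inj rev_ord_inj)/= SE scaler_sumr; apply: eq_bigr => j _.
  have jn : (j <= n)%N by rewrite -ltnS.
  rewrite subSS subKn// vE; last exact: leq_ltn_trans (leq_subr _ _) nm.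
  rewrite linearZ scalerA -exprD; congr (_ ^+ _ *: _).
  by rewrite subnBA// /n subnBA ?ltn_ord// -addnA addKn addnC.
by rewrite (rnormZX _ r)// [leRHS]exprMn -!exprM mulnC.
Qed.

Lemma schwarz_pick_limit (f : R[i]^o -> boundedOp H) (A : nat -> boundedOp H)
    (z : R[i]) (r : R) x y :
  power_expansion_on_disk f A ->
  (forall z : R[i]^o, `|z| < 1 -> opnorm (f z) <= 1) ->
  `|z| = r%:C -> r < 1 ->
  rnorm (f z y + A 0%N x) ^+ 2 + r ^+ 2 / (1 - r ^+ 2) * rnorm (f z y) ^+ 2 <=
  rnorm (y + x) ^+ 2 + r ^+ 2 / (1 - r ^+ 2) * rnorm y ^+ 2.
Proof.
move=> fA f1 zr r1; have r0 : 0 <= r by rewrite -ler0c -zr.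
have z1 : `|z| < 1 by rewrite zr ltcR.
have r21 : r ^+ 2 < 1 by rewrite exprn_ilt1.
set B := _ + _ * rnorm y ^+ 2.
pose S n : boundedOp H := \sum_(k < n) z ^+ k *: A k.
have Scvg u : rnorm (S n y + u) @[n --> \oo] --> rnorm (f z y + u).
  exact: rnorm_expansion_cvg.
have S0cvg : rnorm (S n y) @[n --> \oo] --> rnorm (f z y).
  by have := Scvg 0; rewrite addr0; under eq_fun do rewrite addr0.
(* The number of terms grows with [m], so only [t] of them are kept while [m] tends to infinity; [t]
   tends to infinity afterwards. *)
have lim_t t : rnorm (f z y + A 0%N x) ^+ 2 +
    \sum_(i < t) (r ^+ 2) ^+ i.+1 * rnorm (f z y) ^+ 2 <= B.
  have trunc m : rnorm (S (m + t.+1)%N y + A 0%N x) ^+ 2 +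
      \sum_(i < t) (r ^+ 2) ^+ i.+1 * rnorm (S (m + (t - i))%N y) ^+ 2 <= B.
    apply: le_trans (schwarz_pick_trunc f A z r x y (m + t) fA f1 zr r1).
    rewrite addnS lerD2l (addnC m t) big_split_ord/= -[leLHS]addr0 lerD//.
      rewrite le_eqVlt; apply/orP; left; apply/eqP; apply: eq_bigr => i _.
      by rewrite addnBA 1?ltnW// addnC.
    by apply: sumr_ge0 => i _; rewrite mulr_ge0 ?exprn_ge0 ?rnorm_ge0.
  have sqr_cvg (u : nat -> R) (l : R) :
      u n @[n --> \oo] --> l -> u n ^+ 2 @[n --> \oo] --> l ^+ 2.
    by move=> ul; under eq_fun do rewrite expr2; rewrite expr2; exact: cvgM.
  suff lim : rnorm (S (m + t.+1)%N y + A 0%N x) ^+ 2 +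
      \sum_(i < t) (r ^+ 2) ^+ i.+1 * rnorm (S (m + (t - i))%N y) ^+ 2
      @[m --> \oo] --> rnorm (f z y + A 0%N x) ^+ 2 +
      \sum_(i < t) (r ^+ 2) ^+ i.+1 * rnorm (f z y) ^+ 2.
    by apply: cvgr_to_le lim _; exact: nearW.
  apply: cvgD.
    by apply: sqr_cvg; rewrite (cvg_shiftn t.+1 (fun n => rnorm (S n y + A 0%N x))).
  apply: cvg_big => [|i _]; first exact: add_continuous.
  apply: cvgMl_tmp; apply: sqr_cvg.
  by rewrite (cvg_shiftn (t - i) (fun n => rnorm (S n y))).
have : rnorm (f z y + A 0%N x) ^+ 2 +
  (r ^+ 2 - r ^+ 2 * (r ^+ 2) ^+ t) / (1 - r ^+ 2) * rnorm (f z y) ^+ 2 @[t --> \oo] -->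
  rnorm (f z y + A 0%N x) ^+ 2 + (r ^+ 2 - r ^+ 2 * 0) / (1 - r ^+ 2) * rnorm (f z y) ^+ 2.
  apply: cvgD; first exact: cvg_cst.
  do 2!apply: cvgMr_tmp; apply: cvgB; first exact: cvg_cst.
  by apply: cvgMl_tmp; apply: cvg_expr; rewrite ger0_norm ?sqr_ge0.
rewrite mulr0 subr0 => /cvgr_to_le; apply; apply: nearW => t.
by have := lim_t t; rewrite -mulr_suml sum_exprS ?lt_eqF// (exprS (r ^+ 2)).
Qed.

Lemma schwarz_pick (f : R[i]^o -> boundedOp H) (A : nat -> boundedOp H)
    (a0 z : R[i]) (a r : R) :
  power_expansion_on_disk f A ->
  (forall z : R[i]^o, `|z| < 1 -> opnorm (f z) <= 1) ->
  `|a0| = a%:C -> a < 1 -> A 0%N = a0 *: id_op H ->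
  `|z| = r%:C -> r < 1 ->
  opnorm (f z) <= (a + r) / (1 + a * r).
Proof.
move=> fA f1 aE a1 A0 zr r1.
have a_ge0 : 0 <= a by rewrite -ler0c -aE.
have r_ge0 : 0 <= r by rewrite -ler0c -zr.
have a2 : 0 < 1 - a ^+ 2 by rewrite subr_gt0 exprn_ilt1.
have r2 : 0 < 1 - r ^+ 2 by rewrite subr_gt0 exprn_ilt1.
have ar : 0 < 1 + a * r by rewrite ltr_wpDr// mulr_ge0.
apply: rnorm_opnorm_le => [|y]; first by rewrite divr_ge0 ?addr_ge0 ?mulr_ge0.
set t := f z y; pose c := (1 - a ^+ 2)^-1.
pose v := y - a0^*%R *: t.
(* The perturbation minimizing the quadratic in [x] of [schwarz_pick_limit]. *)
have := schwarz_pick_limit f A z r (- (c%:C *: v)) y fA f1 zr r1.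
have -> : A 0%N (- (c%:C *: v)) = - ((c%:C * a0) *: v).
  by rewrite A0 -[LHS]/(a0 *: (- (c%:C *: v))) scalerN scalerA mulrC.
have cE : c * (1 - a ^+ 2) = 1 by rewrite mulVf// gt_eqF.
have := rnorm_complete_square a0 a c t y aE cE; cbv zeta; rewrite -/t -/v => sq le.
(* The reverse triangle inequality turns the operator estimate into one between the real numbers
   [rnorm y] and [rnorm t]. *)
have vle : `|rnorm y - a * rnorm t| <= rnorm v.
  have -> : a * rnorm t = rnorm (a0^*%R *: t) by rewrite rnormZ norm_conjC aE.
  exact: ler_rnorm_dist.
have : c * rnorm v ^+ 2 <= (1 - r ^+ 2)^-1 * (rnorm y ^+ 2 - rnorm t ^+ 2).
  have -> : (1 - r ^+ 2)^-1 = 1 + r ^+ 2 / (1 - r ^+ 2) by field; rewrite gt_eqF.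
  lra.
move: (rnorm_ge0 y) (rnorm_ge0 t) (rnorm_ge0 v) vle {sq le}.
set X := rnorm y; set T := rnorm t; set V := rnorm v => X0 T0 V0 vle.
rewrite -(ler_pM2l a2) mulrA [_ * c]mulrC cE mul1r.
rewrite mulrCA ler_pdivlMl// => le.
have XT : T <= X.
  rewrite -ler_sqr ?nnegrE// -subr_ge0 -(pmulr_rge0 _ a2) (le_trans _ le)//.
  by rewrite mulr_ge0 ?sqr_ge0// ltW.
have aXT : 0 <= X - a * T by nra.
have VXT : (X - a * T) ^+ 2 <= V ^+ 2 by rewrite ler_sqr ?nnegrE// -(ger0_norm aXT).
rewrite mulrAC ler_pdivlMr//.
suff : T - a * X <= r * (X - a * T) by lra.
have [/ltW Tle0|T_gt] := ltP (T - a * X) 0.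
  by rewrite (le_trans Tle0)// mulr_ge0.
(* Follows from (X - a T)^2 - (T - a X)^2 = (1 - a^2)(X^2 - T^2) and the lower bound (1 - r^2)(X - a
   T)^2 for the right-hand side. *)
rewrite -ler_sqr ?nnegrE ?mulr_ge0//.
nra.
Qed.

(** * The inequality up to the critical radius *)

Lemma bohr_inequality (f : R[i]^o -> boundedOp H) (A : nat -> boundedOp H)
    (p r : R) (z : R[i]) N :
  0 < p -> p <= 1 -> (0 < N)%N -> contractive_with_scalar_A0 f A ->
  `|z| = r%:C -> r < 1 -> bohr_fun p N r <= 0 ->
  ((opnorm (f z) `^ p)%:E
     + \sum_(N <= k <oo) (opnorm (A k) * r ^+ k)%:E <= 1)%E.
Proof.
move=> p0 p1 N0 [_ fA [a0 a01 A0] f1] zr r1 Br.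
have [a aE] : exists a, `|a0| = a%:C.
  by exists (complex.Re `|a0|); rewrite RRe_real ?normr_real.
have a1 : a < 1 by rewrite -ltcR -aE.
have a_ge0 : 0 <= a by rewrite -ler0c -aE.
have r_ge0 : 0 <= r by rewrite -ler0c -zr.
have a2 : 0 <= 1 - a ^+ 2 by rewrite subr_ge0 exprn_ile1// ltW.
have tail : (\sum_(N <= k <oo) (opnorm (A k) * r ^+ k)%:E <=
    ((1 - a ^+ 2) * (r ^+ N / (1 - r)))%:E)%E.
  apply: lime_le.
    by apply: is_cvg_nneseries => k _ _; rewrite lee_fin mulr_ge0 ?opnorm_ge0 ?exprn_ge0.
  apply: nearW => n; rewrite sumEFin lee_fin.
  have [nN|Nn] := leqP n N.
    by rewrite big_geq// mulr_ge0// divr_ge0 ?exprn_ge0// subr_ge0 ltW.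
  apply: le_trans (_ : \sum_(N <= k < n) (1 - a ^+ 2) * r ^+ k <= _).
    rewrite big_nat [leRHS]big_nat; apply: ler_sum => k /andP[Nk _].
    rewrite ler_wpM2r ?exprn_ge0//.
    (* [N >= 1] keeps [k] positive, as [coef_bound] requires. *)
    exact: coef_bound fA f1 aE a1 A0 (leq_trans N0 Nk).
  rewrite -mulr_sumr ler_wpM2l// sum_expr_nat ?lt_eqF// 1?ltnW//.
  apply: ler_wpM2r; first by rewrite invr_ge0 subr_ge0 ltW.
  by rewrite lerBlDr lerDl exprn_ge0.
apply: le_trans (leeD2l _ tail) _; rewrite -EFinD lee_fin.
apply: le_trans (bohr_bound p N a r p0 p1 a_ge0 a1 r_ge0 r1 Br).
rewrite lerD2r; apply: ge0_ler_powR; rewrite ?nnegrE ?opnorm_ge0 ?(ltW p0)//.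
  by rewrite divr_ge0 ?addr_ge0 ?mulr_ge0.
exact: schwarz_pick fA f1 aE a1 A0 zr r1.
Qed.

(** * Möbius functions and sharpness *)

(** The vector [h] guarantees that the identity has norm 1; on the zero space its norm is 0. *)
Lemma opnorm_scalar (c : R[i]) (h : H) : h != 0 ->
  opnorm (c *: id_op H) = complex.Re `|c|.
Proof.
move=> h0; have id1 : opnorm (id_op H) = 1.
  apply/le_anti/andP; split.
    by apply: opnorm_le => // x; rewrite mul1r.
  have := le_opnorm (id_op H) h; rewrite -[X in X <= _]mul1r.
  by rewrite ler_pM2r ?normr_gt0// lecR.
apply: complexI; rewrite opnormZ id1 mulr1.
exact/esym/RRe_real/normr_real.
Qed.

(** The disk automorphism exchanging 0 and [a], times the identity. *)
Definition mobius_op (a : R) (z : R[i]^o) : boundedOp H :=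
  ((a%:C - z) / (1 - a%:C * z)) *: id_op H.

(** Read off from (a - z) / (1 - a z) = a - (1 - a^2) z / (1 - a z). *)
Definition mobius_coef (a : R) (k : nat) : boundedOp H :=
  (if k is k'.+1 then - (1 - a ^+ 2) * a ^+ k' else a)%:C *: id_op H.

Lemma mobius_den_neq0 (a : R) (z : R[i]) : 0 <= a < 1 -> `|z| < 1 ->
  1 - a%:C * z != 0.
Proof.
move=> /andP[a0 a1] z1; rewrite subr_eq0; apply: contraTneq (z1) => az.
have : `|a%:C * z| < 1.
  by rewrite normrM ger0_norm ?ler0c// mulr_ilt1 ?normr_ge0// ?ler0c ?ltcR.
by rewrite -az normr1 ltxx.
Qed.

Lemma cvg_expr_complex (w : R[i]) : `|w| < 1 ->
  (w ^+ n : R[i]^o) @[n --> \oo] --> (0 : R[i]^o).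
Proof.
have [b wb] : exists b : R, `|w| = b%:C.
  by exists (complex.Re `|w|); rewrite RRe_real ?normr_real.
have b0 : 0 <= b by rewrite -ler0c -wb.
rewrite wb ltcR => b1; apply/cvgrPdist_le => e e0.
have eE : (complex.Re e)%:C = e by rewrite RRe_real ?gtr0_real.
have : b ^+ n @[n --> \oo] --> (0 : R) by apply: cvg_expr; rewrite ger0_norm.
move=> /cvgrPdist_le /(_ (complex.Re e)); rewrite -ltcR eE => /(_ e0).
apply: filterS => n bn; rewrite -[leLHS]/(`|0 - w ^+ n : R[i]|).
rewrite sub0r normrN normrX wb -rmorphXn -eE lecR.
by move: bn; rewrite sub0r normrN ger0_norm// exprn_ge0.
Qed.

Lemma mobius_expansion (a : R) : 0 <= a < 1 ->
  power_expansion_on_disk (mobius_op a) (mobius_coef a).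
Proof.
move=> a01 z z1; have /andP[a0 a1] := a01.
have den := mobius_den_neq0 a z a01 z1.
have az1 : `|a%:C * z| < 1.
  by rewrite normrM ger0_norm ?ler0c// mulr_ilt1 ?normr_ge0// ?ler0c ?ltcR.
(* The index starts at [n.+1] because the constant term is outside the geometric progression. *)
have sumE n : series (fun k => z ^+ k *: mobius_coef a k) n.+1 =
    (a%:C - (1 - a ^+ 2)%:C * z * ((1 - (a%:C * z) ^+ n) / (1 - a%:C * z))) *: id_op H.
  rewrite /series/= big_mkord.
  under eq_bigr do rewrite scalerA.
  rewrite -scaler_suml; congr (_ *: _).
  rewrite big_ord_recl expr0 mul1r; congr (_ + _).
  have := sum_expr_nat _ (a%:C * z) 0 n; rewrite big_mkord expr0 => <- //; last first.
    by rewrite eq_sym -subr_eq0.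
  rewrite mulr_sumr -sumrN; apply: eq_bigr => i _.
  have -> : (if nat_of_ord (lift ord0 i) is k'.+1 then - (1 - a ^+ 2) * a ^+ k' else a)%:C =
      - (1 - a ^+ 2)%:C * a%:C ^+ i.
    by rewrite (rmorphM (real_complex R)) rmorphN rmorphXn.
  by rewrite exprMn [z ^+ _]exprS; ring.
rewrite -(cvg_shiftn 1); under eq_fun do rewrite addn1 sumE.
have -> : mobius_op a z =
    (a%:C - (1 - a ^+ 2)%:C * z * ((1 - 0) / (1 - a%:C * z))) *: id_op H.
  rewrite /mobius_op; congr (_ *: _).
  by rewrite (rmorphB (real_complex R)) rmorphXn rmorph1; field.
apply: cvgZr_tmp.
apply: cvgB; first exact: cvg_cst.
apply: cvgMl_tmp; apply: cvgMr_tmp; apply: cvgB; first exact: cvg_cst.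
exact: cvg_expr_complex.
Qed.

Lemma mobius_norm_le1 (a : R) (z : R[i]) : 0 <= a < 1 -> `|z| < 1 ->
  `|(a%:C - z) / (1 - a%:C * z)| <= 1.
Proof.
move=> a01 z1; have /andP[a0 a1] := a01.
have den := mobius_den_neq0 a z a01 z1.
rewrite normf_div ler_pdivrMr ?normr_gt0// mul1r.
rewrite -ler_sqr ?nnegrE// -subr_ge0 !normCK.
have aC : (a%:C)^*%R = a%:C :> R[i] by apply/CrealP; apply/complex_realP; exists a.
rewrite !(rmorphB, rmorphM, rmorph1)/= aC.
rewrite (_ : _ - _ = (1 - a%:C ^+ 2) * (1 - z * z^*%R)); last by ring.
rewrite -normCK; apply: mulr_ge0; rewrite subr_ge0 exprn_ile1 ?normr_ge0 ?ler0c//.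
  by rewrite -(rmorph1 (real_complex R)) lecR ltW.
exact: ltW.
Qed.

Lemma mobius_contractive (a : R) (h : H) : h != 0 -> 0 <= a < 1 ->
  contractive_with_scalar_A0 (mobius_op a) (mobius_coef a).
Proof.
move=> h0 a01; have /andP[a0 a1] := a01; split.
- move=> z z1.
  have dg : derivable (fun w : R[i]^o => (a%:C - w) / (1 - a%:C * w) : R[i]^o) z 1.
    apply: derivableM.
      by apply: derivableB; [exact: derivable_cst|exact: derivable_id].
    apply: derivableV; first exact: mobius_den_neq0.
    apply: derivableB; first exact: derivable_cst.
    by apply: derivableM; [exact: derivable_cst|exact: derivable_id].
  move/cvg_ex: dg => [l gl]; apply/cvg_ex; exists ((l : R[i]) *: id_op H).
  apply: cvg_trans (@cvgZr_tmp _ _ _ _ _ _ _ (id_op H) gl).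
  apply: near_eq_cvg; apply: nearW => w /=.
  by rewrite /mobius_op -scalerBl scalerA.
- exact: mobius_expansion.
- by exists a%:C => //; rewrite ger0_norm ?ler0c ?ltcR.
- move=> z z1; rewrite (opnorm_scalar _ h)// -lecR RRe_real ?normr_real//.
  exact: mobius_norm_le1.
Qed.

Lemma mobius_not_bohr (a p r : R) (h : H) N : h != 0 -> 0 < a < 1 -> 0 <= r < 1 ->
  (0 < N)%N ->
  1 < ((a + r) / (1 + a * r)) `^ p + (1 - a ^+ 2) * a ^+ N.-1 * r ^+ N / (1 - a * r) ->
  ~ ((opnorm (mobius_op a (- r%:C)) `^ p)%:E
     + \sum_(N <= k <oo) (opnorm (mobius_coef a k) * r ^+ k)%:E <= 1)%E.
Proof.
move=> h0 /andP[a0 a1] /andP[r0 r1]; case: N => // N _ /=.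
have ar0 : 0 <= a * r by rewrite mulr_ge0// ltW.
have ar1 : a * r < 1 by rewrite mulr_ilt1// ltW.
have a2 : 0 <= 1 - a ^+ 2 by rewrite subr_ge0 exprn_ile1// ltW.
have -> : opnorm (mobius_op a (- r%:C)) = (a + r) / (1 + a * r).
  rewrite /mobius_op (opnorm_scalar _ h)//.
  have -> : (a%:C - - r%:C) / (1 - a%:C * - r%:C) = ((a + r) / (1 + a * r))%:C.
    by rewrite opprK mulrN opprK (rmorphM (real_complex R)) fmorphV !rmorphD rmorphM rmorph1.
  by rewrite ger0_norm// ler0c divr_ge0 ?addr_ge0// ltW.
have coefE k : opnorm (mobius_coef a k.+1) = (1 - a ^+ 2) * a ^+ k.
  rewrite /mobius_coef (opnorm_scalar _ h)// mulNr rmorphN normrN ger0_norm//.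
  by rewrite ler0c mulr_ge0// exprn_ge0// ltW.
move=> lt1 le; move: lt1; apply/negP; rewrite -leNgt.
pose c := (1 - a ^+ 2) * a ^+ N * r ^+ N.+1.
(* The bound on the infinite sum passes to its partial sums, here in closed form, and their limit
   contradicts the strict inequality. Summing up to [n + N.+1] gives exactly [n] terms. *)
have partial n : ((a + r) / (1 + a * r)) `^ p + c * ((1 - (a * r) ^+ n) / (1 - a * r)) <= 1.
  rewrite -lee_fin EFinD; apply: le_trans le; rewrite leeD2l//.
  apply: le_trans (nneseries_lim_ge (n + N.+1) _); last first.
    by move=> k _ _; rewrite lee_fin mulr_ge0 ?opnorm_ge0 ?exprn_ge0.
  rewrite sumEFin lee_fin -{1}[N.+1]add0n big_addn addnK.
  have := sum_expr_nat _ (a * r) 0 n; rewrite expr0 => <- //; last by rewrite lt_eqF.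
  rewrite mulr_sumr; apply: ler_sum => k _.
  rewrite addnS coefE -addnS (exprD a) (exprD r) exprMn /c.
  by rewrite le_eqVlt; apply/orP; left; apply/eqP; ring.
have : ((a + r) / (1 + a * r)) `^ p + c * ((1 - (a * r) ^+ n) / (1 - a * r)) @[n --> \oo] -->
    ((a + r) / (1 + a * r)) `^ p + c * ((1 - 0) / (1 - a * r)).
  apply: cvgD; first exact: cvg_cst.
  apply: cvgMl_tmp; apply: cvgMr_tmp; apply: cvgB; first exact: cvg_cst.
  by apply: cvg_expr; rewrite ger0_norm.
by rewrite subr0 mul1r => /cvgr_to_le; apply; exact: nearW.
Qed.

End Hilbert.

Theorem lemma3p3 (R : realType) (H : hilbertType R) (p : R) (N : nat)
    (p_gt0 : 0 < p) (p_le1 : p <= 1) (N_ge1 : (1 <= N)%N) :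
  exists R_Np : R,
    [/\ (* R_Np is the unique root in (0, 1) *)
        0 < R_Np < 1 /\ 2 * (1 + R_Np) * R_Np ^+ N - p * (1 - R_Np) ^+ 2 = 0,
        forall x : R, 0 < x < 1 ->
          2 * (1 + x) * x ^+ N - p * (1 - x) ^+ 2 = 0 -> x = R_Np,
        (* the inequality *)
        forall (f : R[i]^o -> boundedOp H) (A : nat -> boundedOp H),
          contractive_with_scalar_A0 f A ->
          forall (z : R[i]^o) (r : R), `|z| = r%:C -> r <= R_Np ->
            ((opnorm (f z) `^ p)%:E
               + \sum_(N <= k <oo) (opnorm (A k) * r ^+ k)%:E <= 1)%E &
        (* sharpness; it would fail on the zero space *)
        (exists h : H, h != 0) ->
        forall r : R, R_Np < r < 1 ->
          exists (f : R[i]^o -> boundedOp H) (A : nat -> boundedOp H),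
            contractive_with_scalar_A0 f A /\
            exists z : R[i]^o, `|z| = r%:C /\
              ~ ((opnorm (f z) `^ p)%:E
                   + \sum_(N <= k <oo) (opnorm (A k) * r ^+ k)%:E <= 1)%E].
Proof.
have [x x01 Bx] := bohr_root_exists p N p_gt0 N_ge1; have /andP[x0 x1] := x01.
exists x; split => //.
- move=> y /andP[y0 y1] By; apply/le_anti/andP; split; rewrite leNgt; apply/negP.
    move=> /(bohr_fun_lt p N x y p_gt0 N_ge1 (ltW x0))/(_ (ltW y1)).
    by rewrite Bx /bohr_fun By ltxx.
  move=> /(bohr_fun_lt p N y x p_gt0 N_ge1 (ltW y0))/(_ (ltW x1)).
  by rewrite Bx /bohr_fun By ltxx.
- move=> f A fA z r zr rx; have r0 : 0 <= r by rewrite -ler0c -zr.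
  apply: bohr_inequality => //; first exact: le_lt_trans rx x1.
  move: rx; rewrite le_eqVlt => /predU1P[->|rx]; first by rewrite Bx.
  by rewrite -Bx ltW// bohr_fun_lt// ltW.
- move=> [h h0] r /andP[xr r1]; have r0 : 0 < r := lt_trans x0 xr.
  have [|a a01 lt1] := bohr_sharp p N r p_gt0 N_ge1 (ltW r0) r1.
    by rewrite -Bx bohr_fun_lt// ltW.
  have /andP[a0 a1] := a01; have a01' : 0 <= a < 1 by rewrite ltW.
  exists (mobius_op a), (mobius_coef a); split; first exact: mobius_contractive h h0 a01'.
  (* At [- r] the Möbius function attains the Schwarz-Pick bound [(a + r) / (1 + a * r)]. *)
  exists (- r%:C); split; first by rewrite normrN ger0_norm ?ler0c ?ltW.
  by apply: mobius_not_bohr h0 a01 _ N_ge1 lt1; rewrite ltW.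
Qed.
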